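(* Consider the stochastic block model with fixed parameters $k\ge2$, $d>0$, $\eta\in[-1/(k-1),1]$. If $d\eta^2<1$ then $\|L^{\le D}\|=O(1)$ for any $D=o(n/\log n)$.
   Context: Stochastic block model on $n$ vertices: under $\mathbb Q$, each edge $(u,v)$, $u<v$, is present independently with probability $d/n$. Under $\mathbb P$, each vertex independently gets a uniformly random label in $[k]$; conditionally on the labels, edges are independent, present with probability $(1+(k-1)\eta)d/n$ if the endpoints share a label and $(1-\eta)d/n$ otherwise. $L=d\mathbb P/d\mathbb Q$; $L^{\le D}$ is its orthogonal projection in $L^2(\mathbb Q)$ onto polynomials of degree $\le D$ in the edge indicator variables; $\|\cdot\|$ is the $L^2(\mathbb Q)$ norm. Asymptotics as $n\to\infty$ with $k,d,\eta$ fixed. *)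

(* Defs.v *)
From HB Require Import structures.
From mathcomp Require Import all_boot all_order all_algebra.
From mathcomp Require mpoly.
Import (canonicals, coercions) mpoly.
From mathcomp Require Import all_classical all_reals all_analysis.

Set Implicit Arguments.
Unset Strict Implicit.
Unset Printing Implicit Defensive.

Import Order.TTheory GRing.Theory Num.Theory.
Import numFieldNormedType.Exports.

Local Open Scope classical_set_scope.
Local Open Scope ring_scope.

Definition edge (n : nat) : finType :=
  {e : 'I_n * 'I_n | (e.1 < e.2)%N}.

Definition graph (n : nat) : finType := {ffun edge n -> bool}.

(* [bernoulli_pmf p b] is [p] for [b = true] and [1 - p] for [b = false] with
   no constraint on [p]; hence the formulas below are probability mass
   functions only when the edge probabilities lie in [0, 1], which holds for
   all large n when the other parameters are fixed. *)
Definition Qmass (R : realType) (d : R) (n : nat) (G : graph n) : R :=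
  \prod_(e : edge n) bernoulli_pmf (d / n%:R) (G e).

Definition sbm_edge_prob (R : realType) (k : nat) (d eta : R) (n : nat)
    (sigma : {ffun 'I_n -> 'I_k}) (e : edge n) : R :=
  if sigma (val e).1 == sigma (val e).2 then
    (1 + (k%:R - 1) * eta) * d / n%:R
  else (1 - eta) * d / n%:R.

Definition Pmass (R : realType) (k : nat) (d eta : R) (n : nat)
    (G : graph n) : R :=
  \sum_(sigma : {ffun 'I_n -> 'I_k})
    (k%:R^-1) ^+ n *
      \prod_(e : edge n) bernoulli_pmf (sbm_edge_prob d eta sigma e) (G e).

(* On a finite space dP/dQ is the ratio of the mass functions; Q charges every
   graph as soon as 0 < d < n. *)
Definition likelihood_ratio (R : realType) (k : nat) (d eta : R) (n : nat)
    (G : graph n) : R :=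
  Pmass k d eta G / Qmass d G.

Definition Q_inner (R : realType) (d : R) (n : nat) (f g : graph n -> R) : R :=
  \sum_(G : graph n) Qmass d G * (f G * g G).

Definition Q_norm (R : realType) (d : R) (n : nat) (f : graph n -> R) : R :=
  Num.sqrt (Q_inner d f f).

(* [mpoly.msize p] is one more than the total degree of [p] (and 0 if
   [p = 0]); the variables of [p] are the edges, numbered by [enum_val]. *)
Definition poly_deg_le (R : realType) (n D : nat) : set (graph n -> R) :=
  [set f | exists p : mpoly.mpoly #|edge n| R,
    (mpoly.msize p <= D.+1)%N /\
    forall G : graph n,
      f G = mpoly.meval (fun i => (G (enum_val i))%:R) p].

Definition is_orth_proj (R : realType) (d : R) (n : nat)
    (V : set (graph n -> R)) (f g : graph n -> R) : Prop :=
  V g /\ forall h, V h -> Q_inner d (f \- g) h = 0.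

(* The orthogonal projection exists and is unique as soon as Q charges every
   graph; [get] returns it then, and an arbitrary value otherwise. *)
Definition low_deg_likelihood (R : realType) (k : nat) (d eta : R)
    (n D : nat) : graph n -> R :=
  get [set g | is_orth_proj d (@poly_deg_le R n D)
                 (@likelihood_ratio R k d eta n) g].

(* Main.v *)
(** Expanding in the characters of the product measure Q reduces the squared
    norm to a sum over edge sets A with |A| <= D of lam^|A| w(A)^2, where
    lam = eta^2 d / (n - d), w(A) = E prod_(uv in A) K(s_u, s_v) and
    K(a, b) = k [a = b] - 1. Writing w(A)^2 as an expectation over two
    independent labellings s, t, and using that every joint moment is a square,
    the sum over sets is dominated by the expectation of the exponential series,
    truncated at degree D, of
    (lam / 2) sum_(u, v) K(s_u, s_v) K(t_u, t_v) = (lam / 2) |W|^2,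
    where W is a sum of n independent centred vectors in dimension k^2 whose
    covariance is at most the identity. Since lam n tends to d eta^2 < 1, the
    part |W| <= eps n is bounded by a Chernoff estimate along finitely many
    directions; on the rest the truncated series is at most e (A n)^D =
    exp(o(n)), which the exponentially small probability absorbs. *)

Require Import Defs.
From mathcomp Require Import all_boot all_order all_algebra.
From mathcomp Require Import all_classical all_reals all_analysis.
From mathcomp Require mpoly.
From mathcomp Require Import ring lra.
Import (canonicals, coercions) mpoly.
Import Order.TTheory GRing.Theory Num.Theory.
Import numFieldNormedType.Exports.
Set Implicit Arguments.
Unset Strict Implicit.
Unset Printing Implicit Defensive.
Local Open Scope classical_set_scope.
Local Open Scope ring_scope.

(** * Exponential series *)

(** Mean value theorem for the difference [f] of the two sides: [f] vanishes at 0, and near 0 its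
    derivative at a point has the sign of that point. *)
Lemma expR_le_quadratic (R : realType) (delta : R) : 0 < delta ->
  exists2 x0 : R, 0 < x0 &
    forall x, `|x| <= x0 -> expR x <= 1 + x + (1 + delta) / 2 * x ^+ 2.
Proof.
move=> delta0; exists (delta / (1 + delta)); first by rewrite divr_gt0// addr_gt0.
move=> x hx.
pose f (y : R) : R := 1 + y + (1 + delta) / 2 * y ^+ 2 - expR y.
have df (y : R) : is_derive y (1 : R) f (1 + (1 + delta) * y - expR y).
  rewrite /f; apply: is_derive_eq.
  by rewrite /GRing.scale /=; field.
have cf : continuous f.
  by move=> y; apply/differentiable_continuous/derivable1_diffP; apply: ex_derive.
have f0 : f 0 = 0 by rewrite /f expR0; ring.
suff : 0 <= f x by rewrite /f subr_ge0.
have [x_ge0|/ltW x_le0] := lerP 0 x.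
  have [c cx] := MVT_segment x_ge0 (fun y _ => df y) (continuous_subspaceT cf).
  rewrite f0 !subr0 => ->; rewrite mulr_ge0//.
  move: cx; rewrite in_itv/= => /andP[c0 cx].
  have cd : c * (1 + delta) <= delta.
    by rewrite -ler_pdivlMr ?addr_gt0//; move: hx; rewrite ger0_norm//; lra.
  have c1 : c < 1 by nra.
  have : expR c * (1 - c) <= 1.
    have := expR_ge1Dx (- c); rewrite expRN => h.
    have ec := expR_gt0 c.
    have := ler_wpM2l (ltW ec) h; rewrite divff ?gt_eqF//.
  (* The radius delta / (1 + delta) is chosen for this bound, which is combined with exp c <= 1 / (1
     - c). *)
  have hc : 1 <= (1 + (1 + delta) * c) * (1 - c) by nra.
  move=> h; have := le_trans h hc; rewrite ler_pM2r ?subr_gt0//; lra.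
have [c cx] := MVT_segment x_le0 (fun y _ => df y) (continuous_subspaceT cf).
rewrite f0 !sub0r => /eqP; rewrite eqr_oppLR mulrN opprK => /eqP ->.
rewrite mulr_le0//; move: cx; rewrite in_itv/= => /andP[_ c0].
have := expR_ge1Dx c; nra.
Qed.

Definition truncated_exp (R : realType) (D : nat) (x : R) : R :=
  \sum_(m < D.+1) x ^+ m / m`!%:R.

Lemma truncated_exp_ge0 (R : realType) D (x : R) : 0 <= x -> 0 <= truncated_exp D x.
Proof. by move=> x0; apply: sumr_ge0 => m _; rewrite divr_ge0// exprn_ge0. Qed.

Lemma le_truncated_exp (R : realType) D (x y : R) :
  0 <= x -> x <= y -> truncated_exp D x <= truncated_exp D y.
Proof.
by move=> x0 xy; apply: ler_sum => m _; rewrite ler_wpM2r// lerXn2r// nnegrE (le_trans x0).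
Qed.

Lemma truncated_exp_le_expR (R : realType) D (x : R) :
  0 <= x -> truncated_exp D x <= expR x.
Proof.
move=> x0; have -> : truncated_exp D x = series (exp_coeff x) D.+1.
  by rewrite /series/= big_mkord; apply: eq_bigr.
apply: nondecreasing_cvgn_le; last exact: is_cvg_series_exp_coeff.
by apply/nondecreasing_seqP => n; rewrite seriesSr lerDl exp_coeff_ge0.
Qed.

(** Every power that occurs is at most x^D. This serves where x is of order n and exp x would be too
    large. *)
Lemma truncated_exp_le_pow (R : realType) D (x : R) :
  1 <= x -> truncated_exp D x <= x ^+ D * expR 1.
Proof.
move=> x1; apply: (@le_trans _ _ (x ^+ D * truncated_exp D 1)); last first.
  by rewrite ler_wpM2l ?truncated_exp_le_expR// exprn_ge0// (le_trans ler01).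
rewrite mulr_sumr; apply: ler_sum => m _; rewrite expr1n mulrA mulr1.
by rewrite ler_wpM2r// ler_weXn2l// -ltnS.
Qed.

(** Completing the square gives b j - a j^2 <= (b + 1)^2 / (4 a) - j, which leaves a geometric
    series of ratio 1/e <= 1/2. *)
Lemma sum_expR_quadratic_bounded (R : realType) (a b : R) : 0 < a ->
  exists C : R, forall J : nat, \sum_(j < J) expR (b * j%:R - a * j%:R ^+ 2) <= C.
Proof.
move=> a0; exists (2 * expR ((b + 1) ^+ 2 / (4 * a))) => J.
have half n : \sum_(j < n) (2^-1 : R) ^+ j <= 2 - 2 * 2^-1 ^+ n.
  elim: n => [|n ih]; first by rewrite big_ord0 expr0; lra.
  rewrite big_ord_recr/= exprS; lra.
have -> : 2 * expR ((b + 1) ^+ 2 / (4 * a)) = expR ((b + 1) ^+ 2 / (4 * a)) * 2 :> R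
  by rewrite mulrC.
apply: (@le_trans _ _ (expR ((b + 1) ^+ 2 / (4 * a)) * \sum_(j < J) 2^-1 ^+ j)); last first.
  rewrite ler_wpM2l ?expR_ge0//; apply: le_trans (half J) _.
  by rewrite lerBlDr lerDl mulr_ge0// exprn_ge0// invr_ge0.
rewrite mulr_sumr; apply: ler_sum => j _.
apply: (@le_trans _ _ (expR ((b + 1) ^+ 2 / (4 * a) - j%:R))).
  rewrite ler_expR -subr_ge0.
  have -> : (b + 1) ^+ 2 / (4 * a) - j%:R - (b * j%:R - a * j%:R ^+ 2) =
      a * (j%:R - (b + 1) / (2 * a)) ^+ 2 by field; rewrite gt_eqF.
  by rewrite mulr_ge0 ?sqr_ge0// ltW.
rewrite expRD ler_wpM2l ?expR_ge0// expRN -[X in expR X]mulr1 expRM_natl exprVn.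
rewrite lef_pV2 ?posrE ?exprn_gt0 ?expR_gt0//.
by rewrite lerXn2r ?nnegrE ?expR_ge0//; have := @expR_ge1Dx R 1; lra.
Qed.

(** * Averages and moments *)

Definition avg (R : realFieldType) (T : finType) (f : T -> R) : R :=
  (\sum_x f x) / #|T|%:R.

Section Average.
Variable R : realFieldType.
Implicit Types T I : finType.

Lemma avg_cst T (c : R) : (0 < #|T|)%N -> avg (fun _ : T => c) = c.
Proof.
by move=> T0; rewrite /avg sumr_const -[_ *+ _]mulr_natr mulfK// pnatr_eq0 -lt0n.
Qed.

Lemma eq_avg T (f g : T -> R) : f =1 g -> avg f = avg g.
Proof. by move=> fg; rewrite /avg; congr (_ / _); apply: eq_bigr => x _. Qed.

Lemma le_avg T (f g : T -> R) : (forall x, f x <= g x) -> avg f <= avg g.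
Proof. by move=> fg; rewrite ler_wpM2r// ler_sum. Qed.

Lemma avg_ge0 T (f : T -> R) : (forall x, 0 <= f x) -> 0 <= avg f.
Proof. by move=> f0; rewrite mulr_ge0 ?invr_ge0// sumr_ge0. Qed.

Lemma avgD T (f g : T -> R) : avg (fun x => f x + g x) = avg f + avg g.
Proof. by rewrite /avg big_split mulrDl. Qed.

Lemma avgZ T (c : R) (f : T -> R) : avg (fun x => c * f x) = c * avg f.
Proof. by rewrite /avg -mulr_sumr mulrA. Qed.

Lemma avg_sum T I (P : pred I) (f : I -> T -> R) :
  avg (fun x => \sum_(i | P i) f i x) = \sum_(i | P i) avg (f i).
Proof. by rewrite /avg exchange_big/= mulr_suml. Qed.

Lemma avg_mul T I (f : T -> R) (g : I -> R) :
  avg (fun p : T * I => f p.1 * g p.2) = avg f * avg g.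
Proof.
rewrite /avg card_prod natrM invfM mulrACA; congr (_ * _).
by rewrite big_distrlr/= pair_big.
Qed.

(** The pairs of labels at distinct vertices are independent and uniform, so the expectation
    factorises. *)
Lemma avg_ffun_prod n T I (h : T -> I -> R) :
  avg (fun p : {ffun 'I_n -> T} * {ffun 'I_n -> I} => \prod_u h (p.1 u) (p.2 u)) =
  avg (fun q : T * I => h q.1 q.2) ^+ n.
Proof.
rewrite /avg !card_prod !card_ffun !card_ord expr_div_n -expnMn natrX; congr (_ / _).
rewrite -(pair_big xpredT xpredT (fun (s : {ffun 'I_n -> T}) (t : {ffun 'I_n -> I}) =>
  \prod_u h (s u) (t u)))/=.
under eq_bigr => s _ do rewrite -(bigA_distr_bigA (fun u b => h (s u) b)).
rewrite -(bigA_distr_bigA (fun _ a => \sum_b h a b)) prodr_const card_ord.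
by rewrite (pair_big xpredT xpredT h).
Qed.

End Average.

(** Each set of size m is the image of exactly m! injective words. *)
Lemma sum_sets_of_card (R : realFieldType) (E : finType) m (F : {set E} -> R) :
  m`!%:R * (\sum_(A : {set E} | #|A| == m) F A) =
  \sum_(f : {ffun 'I_m -> E} | injectiveb f) F [set f i | i in 'I_m]%SET.
Proof.
rewrite (partition_big (fun f : {ffun 'I_m -> E} => [set f i | i in 'I_m]%SET)
  (fun A => #|A| == m))/=; last first.
  by move=> f /injectiveP f_inj; rewrite card_imset// card_ord.
rewrite mulr_sumr; apply: eq_bigr => A /eqP Am.
rewrite (eq_bigr (fun _ => F A)); last by move=> f /andP[_ /eqP ->].
rewrite sumr_const -[RHS]mulr_natl; congr (_%:R * _).
rewrite -ffactnn -{1}Am -[X in (_ ^_ X)%N]card_ord.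
rewrite -(card_inj_ffuns_on 'I_m (mem A)) -!sum1_card; apply: eq_bigl => f.
rewrite inE [RHS]andbC; apply: andb_id2r => /injectiveP f_inj.
apply/ffun_onP/eqP => [fA|<- i]; last by rewrite imset_f.
apply/eqP; rewrite eqEcard card_imset// Am card_ord leqnn andbT.
by apply/fintype.subsetP => _ /imsetP[i _ ->]; apply: fA.
Qed.

Section Moments.
Variables (R : realType) (T E : finType) (K : T -> E -> R).

(** Expand the power over words of length m; since the two replicas are independent, each word
    contributes a square. *)
Lemma avg_pow_sum_mul m :
  avg (fun p : T * T => (\sum_e K p.1 e * K p.2 e) ^+ m) =
  \sum_(f : {ffun 'I_m -> E}) avg (fun s => \prod_i K s (f i)) ^+ 2.
Proof.
under eq_avg => p.
  rewrite -[X in _ ^+ X]card_ord -prodr_const bigA_distr_bigA/=.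
  under eq_bigr => f _ do rewrite big_split/=.
  over.
rewrite avg_sum; apply: eq_bigr => f _.
by rewrite (avg_mul (fun s => \prod_i K s (f i)) (fun s => \prod_i K s (f i))).
Qed.

Lemma avg_pow_sum_mul_ge0 m :
  0 <= avg (fun p : T * T => (\sum_e K p.1 e * K p.2 e) ^+ m).
Proof. by rewrite avg_pow_sum_mul sumr_ge0// => f _; rewrite sqr_ge0. Qed.

(* Words without repetition give each set of m edges m! times; the other words
   contribute squares. *)
Lemma sum_sqr_avg_prod_card_le m :
  \sum_(A : {set E} | #|A| == m) avg (fun s => \prod_(e in A) K s e) ^+ 2 <=
  avg (fun p : T * T => (\sum_e K p.1 e * K p.2 e) ^+ m) / m`!%:R.
Proof.
rewrite ler_pdivlMr ?ltr0n ?fact_gt0// mulrC sum_sets_of_card avg_pow_sum_mul.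
rewrite [leRHS](bigID (fun f : {ffun 'I_m -> E} => injectiveb f))/=.
rewrite (eq_bigr (fun f : {ffun 'I_m -> E} => avg (fun s => \prod_i K s (f i)) ^+ 2)).
  by rewrite lerDl sumr_ge0// => f _; rewrite sqr_ge0.
move=> f /injectiveP f_inj; congr (_ ^+ 2); apply: eq_avg => s.
by rewrite big_imset//= => i j _ _; apply: f_inj.
Qed.

Lemma sum_sqr_avg_prod_le D (lam : R) : 0 <= lam ->
  \sum_(A : {set E} | (#|A| <= D)%N) lam ^+ #|A| * avg (fun s => \prod_(e in A) K s e) ^+ 2 <=
  avg (fun p : T * T => truncated_exp D (lam * \sum_e K p.1 e * K p.2 e)).
Proof.
move=> lam0; rewrite avg_sum.
(* Sets are sorted by size; [inord] is faithful here because only sizes at most D occur. *)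
rewrite (partition_big (fun A : {set E} => inord #|A| : 'I_D.+1) xpredT)//=.
apply: ler_sum => m _.
under [leRHS]eq_avg => p do rewrite exprMn mulrAC.
rewrite avgZ mulrAC -mulrA.
apply: (@le_trans _ _ (lam ^+ m *
  \sum_(A : {set E} | #|A| == m) avg (fun s => \prod_(e in A) K s e) ^+ 2)); last first.
  by rewrite ler_wpM2l ?exprn_ge0// sum_sqr_avg_prod_card_le.
rewrite mulr_sumr le_eqVlt; apply/orP; left; apply/eqP.
have card_m (A : {set E}) : (#|A| <= D)%N && (inord #|A| == m) = (#|A| == m).
  apply/andP/eqP => [[AD /eqP <-]|Am]; first by rewrite inordK.
  by rewrite Am -ltnS ltn_ord inord_val.
by rewrite (eq_bigl _ _ card_m); apply: eq_bigr => A /eqP ->.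
Qed.

(** All moments of the sum are nonnegative, so in the binomial expansion the terms containing c only
    add. The sum itself may be negative, so monotonicity of the series does not apply pointwise. *)
Lemma avg_truncated_exp_le_add D (lam c : R) : 0 <= lam -> 0 <= c ->
  avg (fun p : T * T => truncated_exp D (lam * \sum_e K p.1 e * K p.2 e)) <=
  avg (fun p : T * T => truncated_exp D (lam * (c + \sum_e K p.1 e * K p.2 e))).
Proof.
move=> lam0 c0; rewrite !avg_sum; apply: ler_sum => m _.
under eq_avg => p do rewrite exprMn mulrAC.
under [leRHS]eq_avg => p do rewrite exprMn mulrAC.
rewrite !avgZ ler_wpM2l ?divr_ge0 ?exprn_ge0//.
under [leRHS]eq_avg => p.
  rewrite exprDn; under eq_bigr => j _ do rewrite -mulrnAl.
  over.
rewrite avg_sum big_ord_recr/= avgZ subnn expr0 binn mulr1n mul1r lerDr sumr_ge0// => j _.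
by rewrite avgZ mulr_ge0 ?avg_pow_sum_mul_ge0// mulrn_wge0// exprn_ge0.
Qed.

End Moments.

(** * Fourier expansion under Q *)

Lemma sum_graph_prod (R : comNzRingType) n (h : edge n -> bool -> R) :
  \sum_(G : graph n) \prod_e h e (G e) = \prod_e (h e true + h e false).
Proof.
by rewrite -bigA_distr_bigA; apply: eq_bigr => e _; rewrite big_bool.
Qed.

(** Centred at p but not normalised: for p = d / n the squared norm under Q is (p (1 - p))^|A|. *)
Definition edge_character (R : nzRingType) n (p : R) (A : {set edge n}) (G : graph n) : R :=
  \prod_(e in A) ((G e)%:R - p).

Lemma Q_inner_character (R : realType) (d : R) n (A B : {set edge n}) :
  Q_inner d (edge_character (d / n%:R) A) (edge_character (d / n%:R) B) =
  (d / n%:R * (1 - d / n%:R)) ^+ #|A| *+ (A == B).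
Proof.
set p := d / n%:R.
rewrite /Q_inner /Qmass /edge_character -/p.
under eq_bigr => G _ do
  rewrite [\prod_(e in A) _]big_mkcond [\prod_(e in B) _]big_mkcond/= -2!big_split/=.
rewrite (sum_graph_prod (fun e b => bernoulli_pmf p b *
   ((if e \in A then b%:R - p else 1) * (if e \in B then b%:R - p else 1)))).
have [<-|neq] := eqVneq A B.
  rewrite mulr1n -prodr_const [RHS]big_mkcond/=; apply: eq_bigr => e _.
  by case: ifP => _ /=; ring.
(* An edge in exactly one of the two sets contributes a centred factor, whose mean is 0. *)
have /set0Pn[e] : ((A :\: B) :|: (B :\: A))%SET != finset.set0.
  apply: contra neq; rewrite finset.setU_eq0 !finset.setD_eq0 => /andP[? ?].
  by rewrite finset.eqEsubset; apply/andP.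
rewrite mulr0n (bigD1 e)//= !inE => /orP[/andP[/negbTE eB eA]|/andP[/negbTE eA eB]];
  rewrite eA eB; apply/eqP; rewrite mulf_eq0; apply/orP; left; apply/eqP; ring.
Qed.

Definition character_span (R : nzRingType) n (p : R) (D : nat) (f : graph n -> R) : Prop :=
  exists c : {set edge n} -> R, forall G,
    f G = \sum_(A : {set edge n} | (#|A| <= D)%N) c A * edge_character p A G.

(** Writing each indicator as (G e - p) + p and expanding leaves the subsets A of B, with
    coefficient p^|B \ A|. *)
Lemma character_span_prod_indicators (R : realType) n (p : R) D (B : {set edge n}) :
  (#|B| <= D)%N -> character_span p D (fun G : graph n => \prod_(e in B) (G e)%:R).
Proof.
move=> BD; exists (fun A : {set edge n} => if A \subset B then p ^+ #|B :\: A| else 0) => G.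
have -> : \prod_(e in B) (G e)%:R =
    \prod_e ((if e \in B then (G e)%:R - p else 0) + (if e \in B then p else 1)).
  rewrite big_mkcond/=; apply: eq_bigr => e _; case: ifP => _; ring.
rewrite bigA_distr big_mkcond [RHS]big_mkcond/=; apply: eq_bigr => A _.
have [AB|/subsetPn[e eA eB]] := boolP (A \subset B); last first.
  by rewrite mul0r if_same (bigD1 e)//= eA (negbTE eB) mul0r.
rewrite (leq_trans (subset_leq_card AB) BD) mulrC -prodr_const /edge_character.
rewrite [X in X * _]big_mkcond [X in _ * X]big_mkcond -big_split/=.
apply: eq_bigr => e _; rewrite !inE.
have [eA|eA] := boolP (e \in A); first by rewrite (fintype.subsetP AB)// mulr1.
by rewrite mul1r.
Qed.

(** Indicators take the values 0 and 1, so a monomial equals the product over its support, whose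
    size is at most its degree. *)
Lemma poly_deg_le_character_span (R : realType) n (p : R) D (f : graph n -> R) :
  poly_deg_le D f -> character_span p D f.
Proof.
case=> P [sP fP].
suff /(_ _ (fun m h => leq_trans (mpoly.msize_mdeg_lt h) sP)) [c hc] :
    forall s : seq (mpoly.multinom #|edge n|),
    (forall m, m \in s -> (mpoly.mdeg m < D.+1)%N) ->
    character_span p D (fun G => \sum_(m <- s) mpoly.mcoeff m P *
      \prod_i ((G (enum_val i))%:R : R) ^+ m i).
  by exists c => G; rewrite fP mpoly.mevalE hc.
elim=> [|m s ih] hs.
  by exists (fun _ => 0) => G; rewrite big_nil big1// => A _; rewrite mul0r.
have [|c1 hc1] := ih; first by move=> m' hm'; apply: hs; rewrite inE hm' orbT.
pose B := [set e | m (enum_rank e) != 0%N]%SET.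
have BD : (#|B| <= D)%N.
  have := hs m; rewrite inE eqxx ltnS => /(_ isT); apply: leq_trans.
  rewrite mpoly.mdegE (reindex (@enum_rank (edge n)))/=; last first.
    by exists enum_val => ? _; rewrite ?enum_rankK ?enum_valK.
  rewrite -sum1_card big_mkcond/=; apply: leq_sum => e _.
  by rewrite inE; case: (m _).
have [c2 hc2] := character_span_prod_indicators p BD.
exists (fun A => mpoly.mcoeff m P * c2 A + c1 A) => G.
rewrite big_cons hc1.
under [RHS]eq_bigr => A _ do rewrite mulrDl -mulrA.
rewrite big_split/= -mulr_sumr -hc2; congr (_ * _ + _).
rewrite (reindex (@enum_rank (edge n)))/=; last first.
  by exists enum_val => ? _; rewrite ?enum_rankK ?enum_valK.
rewrite [RHS]big_mkcond/=; apply: eq_bigr => e _; rewrite enum_rankK inE.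
by case: (m _) => //= j; case: (G e); rewrite ?expr1n ?exprS ?mul0r.
Qed.

Lemma Q_inner_suml (R : realType) (d : R) n (I : finType) (P : pred I)
    (c : I -> R) (f : I -> graph n -> R) (g : graph n -> R) :
  Q_inner d (fun G => \sum_(i | P i) c i * f i G) g =
  \sum_(i | P i) c i * Q_inner d (f i) g.
Proof.
rewrite /Q_inner; under [RHS]eq_bigr => i _ do rewrite mulr_sumr.
rewrite exchange_big/=; apply: eq_bigr => G _; rewrite mulr_suml mulr_sumr.
by apply: eq_bigr => i _; ring.
Qed.

Lemma Q_innerC (R : realType) (d : R) n (f g : graph n -> R) :
  Q_inner d f g = Q_inner d g f.
Proof. by apply: eq_bigr => G _; rewrite [f G * _]mulrC. Qed.

(** A Bessel inequality. Testing orthogonality against g gives <f, g> = <g, g>; after expanding g in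
    characters, 2 c l <= c^2 q + l^2 / q is applied term by term. *)
Lemma Q_inner_orth_proj_le (R : realType) (d : R) n D (f g : graph n -> R) :
  0 < d -> d < n%:R -> is_orth_proj d (@poly_deg_le R n D) f g ->
  Q_inner d g g <= \sum_(A : {set edge n} | (#|A| <= D)%N)
    Q_inner d f (edge_character (d / n%:R) A) ^+ 2 / (d / n%:R * (1 - d / n%:R)) ^+ #|A|.
Proof.
move=> d0 dn [gV /(_ g gV) gorth].
set p := d / n%:R.
have n0 : 0 < n%:R :> R := lt_trans d0 dn.
have q0 : 0 < p * (1 - p) by rewrite mulr_gt0 ?divr_gt0// subr_gt0 ltr_pdivrMr// mul1r.
have [c hc] := poly_deg_le_character_span p gV.
have eg : g = fun G => \sum_(A : {set edge n} | (#|A| <= D)%N) c A * edge_character p A G.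
  by apply/funext.
have fg : Q_inner d f g = Q_inner d g g.
  apply/eqP; rewrite -subr_eq0 -gorth /Q_inner -sumrB; apply/eqP; apply: eq_bigr => G _.
  by rewrite /=; ring.
have gg : Q_inner d g g = \sum_(A : {set edge n} | (#|A| <= D)%N) c A ^+ 2 * (p * (1 - p)) ^+ #|A|.
  rewrite {1}eg Q_inner_suml; apply: eq_bigr => A AD; rewrite expr2 -mulrA; congr (_ * _).
  rewrite Q_innerC eg Q_inner_suml (bigD1 A)//= Q_inner_character eqxx mulr1n big1 ?addr0// => B.
  by case/andP=> _ /negbTE BA; rewrite Q_inner_character BA mulr0n mulr0.
have fg' : Q_inner d f g = \sum_(A : {set edge n} | (#|A| <= D)%N) c A * Q_inner d f (edge_character p A).
  by rewrite Q_innerC {1}eg Q_inner_suml; apply: eq_bigr => A _; rewrite Q_innerC.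
have : 2 * Q_inner d f g <= Q_inner d g g + \sum_(A : {set edge n} | (#|A| <= D)%N)
    Q_inner d f (edge_character p A) ^+ 2 / (p * (1 - p)) ^+ #|A|.
  rewrite fg' gg mulr_sumr -big_split/=; apply: ler_sum => A _.
  set q := _ ^+ #|A|; have qA : 0 < q by rewrite exprn_gt0.
  set l := Q_inner _ _ _; rewrite -subr_ge0.
  have -> : c A ^+ 2 * q + l ^+ 2 / q - 2 * (c A * l) = q * (c A - l / q) ^+ 2.
    by field; rewrite gt_eqF.
  by rewrite mulr_ge0 ?sqr_ge0// ltW.
rewrite fg; lra.
Qed.

(** * Chernoff bounds *)

(** Apply the quadratic bound at t xi: the linear term averages to 0, the variance is at most 1, and
    1 + y <= exp y. *)
Lemma avg_expR_le (R : realType) (T : finType) (xi : T -> R) (delta B x0 t : R) :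
  (0 < #|T|)%N -> avg xi = 0 -> avg (fun x => xi x ^+ 2) <= 1 ->
  (forall x, `|xi x| <= B) -> 0 <= delta ->
  (forall x, `|x| <= x0 -> expR x <= 1 + x + (1 + delta) / 2 * x ^+ 2) ->
  `|t| * B <= x0 ->
  avg (fun x => expR (t * xi x)) <= expR ((1 + delta) / 2 * t ^+ 2).
Proof.
move=> T0 mean0 var1 xiB delta0 hexp tB.
apply: le_trans (expR_ge1Dx _).
apply: (@le_trans _ _ (avg (fun x => 1 + t * xi x + (1 + delta) / 2 * t ^+ 2 * xi x ^+ 2))).
  apply: le_avg => x; rewrite -[X in _ + X]mulrA -exprMn; apply: hexp.
  by rewrite normrM (le_trans _ tB)// ler_wpM2l.
rewrite !avgD !avgZ avg_cst// mean0 mulr0 addr0 lerD2l ler_piMr//.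
by rewrite mulr_ge0 ?sqr_ge0// divr_ge0// addr_ge0.
Qed.

(* The levels [j, j + 1) below a are each charged to the exponential moment
   tilted at c3 * j, everything above a to the one tilted at c3 * a. *)
Lemma avg_level_bound (R : realType) (P : finType) (X : P -> R) (F : R -> R)
    (a c2 c3 M : R) :
  (0 < #|P|)%N -> 0 <= a -> 0 <= c2 -> 0 < c3 -> 0 <= M ->
  (forall t, 0 <= t <= c3 * a -> avg (fun p => expR (t * X p)) <= expR (t ^+ 2 / (2 * c3))) ->
  (forall p, X p <= 0 -> F (X p) <= 1) ->
  (forall p, 0 <= X p <= a -> F (X p) <= expR (c2 / 2 * X p ^+ 2)) ->
  (forall p, a <= X p -> F (X p) <= M) ->
  avg (fun p => F (X p)) <= 1 +
    \sum_(j < (Num.truncn a).+1) expR (c2 / 2 * (j%:R + 1) ^+ 2 - c3 / 2 * j%:R ^+ 2) +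
    M * expR (- (c3 / 2 * a ^+ 2)).
Proof.
move=> P0 a0 c20 c30 M0 mgf F_neg F_mid F_big.
pose G p := 1 +
  \sum_(j < (Num.truncn a).+1) expR (c2 / 2 * (j%:R + 1) ^+ 2 - c3 * j%:R ^+ 2) * expR (c3 * j%:R * X p)
  + M * expR (- (c3 * a ^+ 2)) * expR (c3 * a * X p).
have sum_ge0 p : 0 <= \sum_(j < (Num.truncn a).+1)
    expR (c2 / 2 * (j%:R + 1) ^+ 2 - c3 * j%:R ^+ 2) * expR (c3 * j%:R * X p).
  by apply: sumr_ge0 => j _; rewrite mulr_ge0 ?expR_ge0.
have last_ge0 p : 0 <= M * expR (- (c3 * a ^+ 2)) * expR (c3 * a * X p).
  by rewrite !mulr_ge0 ?expR_ge0.
apply: (@le_trans _ _ (avg G)).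
  apply: le_avg => p; rewrite /G.
  have [X0|X0] := lerP (X p) 0.
    by apply: le_trans (F_neg _ X0) _; rewrite -addrA lerDl addr_ge0.
  have [Xa|Xa] := lerP (X p) a; last first.
    apply: le_trans (F_big _ (ltW Xa)) _.
    rewrite -[leLHS]add0r lerD ?addr_ge0//.
    rewrite -mulrA -expRD ler_peMr// -[leLHS]expR0 ler_expR.
    have -> : - (c3 * a ^+ 2) + c3 * a * X p = c3 * a * (X p - a) by ring.
    by rewrite mulr_ge0 ?mulr_ge0 ?subr_ge0// ltW.
  apply: le_trans (F_mid _ _) _; first by rewrite (ltW X0).
  (* The level j = floor (X p) suffices: X p < j + 1 bounds F, and j <= X p makes the tilted factor
     at least 1. *)
  have /andP[jX Xj] := truncn_itv (ltW X0).
  have jJ : (Num.truncn (X p) < (Num.truncn a).+1)%N.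
    by rewrite ltnS le_truncn.
  rewrite -[leLHS]addr0 lerD// -[leLHS]add0r lerD//.
  rewrite (bigD1 (Ordinal jJ))//= -[leLHS]addr0 lerD//; last first.
    by apply: sumr_ge0 => j _; rewrite mulr_ge0 ?expR_ge0.
  set j := Num.truncn _ in jX Xj *.
  rewrite -expRD ler_expR -[leLHS]addr0 -addrA lerD//.
    by rewrite ler_wpM2l ?divr_ge0// lerXn2r ?nnegrE ?addr_ge0// ?ltW// natr1.
  have -> : - (c3 * j%:R ^+ 2) + c3 * j%:R * X p = c3 * j%:R * (X p - j%:R) by ring.
  by rewrite mulr_ge0 ?mulr_ge0 ?subr_ge0// ltW.
(* With t = c3 j the exponent - c3 j^2 + t^2 / (2 c3) equals - c3 j^2 / 2; likewise at t = c3 a. *)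
rewrite /G !avgD avg_cst// avg_sum avgZ; apply: lerD.
  rewrite lerD2l; apply: ler_sum => j _; rewrite avgZ.
  have ja : j%:R <= a.
    have ta : (Num.truncn a)%:R <= a by rewrite truncn_le.
    by apply: le_trans ta; rewrite ler_nat -ltnS ltn_ord.
  apply: le_trans (ler_wpM2l (expR_ge0 _) (mgf _ _)) _.
    by rewrite mulr_ge0 ?(ltW c30)//= ler_wpM2l// ltW.
  rewrite -expRD ler_expR le_eqVlt; apply/orP; left; apply/eqP; field.
  by rewrite gt_eqF.
rewrite -[leLHS]mulrA ler_wpM2l//.
apply: le_trans (ler_wpM2l (expR_ge0 _) (mgf _ _)) _.
  by rewrite mulr_ge0 ?lexx// ltW.
rewrite -expRD ler_expR le_eqVlt; apply/orP; left; apply/eqP; field.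
by rewrite gt_eqF.
Qed.

(** A finite net: each coordinate is a sign and a numerator over M. A union bound over directions is
    then a finite sum; vectors of norm above 1 are filtered out where it is used. *)
Definition grid_vector (R : realType) (J : finType) M
    (g : {ffun J -> bool * 'I_M.+1}) (j : J) : R :=
  (-1) ^+ (g j).1 * (g j).2%:R / M%:R.

(* Rounding y / |y| towards 0 on the grid of mesh 1 / M loses at most 1 / M in
   each coordinate and does not increase the norm. *)
Lemma exists_grid_direction (R : realType) (J : finType) M (y : J -> R) : (0 < M)%N ->
  exists g : {ffun J -> bool * 'I_M.+1},
    [/\ \sum_j grid_vector R g j ^+ 2 <= 1,
        0 <= \sum_j grid_vector R g j * y j &
        (1 - #|J|%:R / M%:R) * Num.sqrt (\sum_j y j ^+ 2) <= \sum_j grid_vector R g j * y j].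
Proof.
move=> M0; set q := \sum_j y j ^+ 2.
have q0 : 0 <= q by apply: sumr_ge0 => j _; rewrite sqr_ge0.
have M0' : 0 < M%:R :> R by rewrite ltr0n.
have [s0|s_neq0] := eqVneq (Num.sqrt q) 0.
  exists [ffun=> (false, ord0)]; rewrite s0 mulr0.
  have v0 j : grid_vector R [ffun=> (false, ord0 : 'I_M.+1)] j = 0.
    by rewrite /grid_vector ffunE/= mulr0 mul0r.
  split; rewrite big1 => // j _; rewrite v0 ?mul0r ?expr0n//.
set s := Num.sqrt q; have s0 : 0 < s by rewrite lt_def s_neq0 sqrtr_ge0.
have sq : s ^+ 2 = q by rewrite sqr_sqrtr.
have ys j : `|y j| <= s.
  have : `|y j| ^+ 2 <= s ^+ 2.
    rewrite sq real_normK ?num_real//.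
    rewrite [leRHS](bigD1 j)//= lerDl.
    by apply: sumr_ge0 => i _; rewrite sqr_ge0.
  by rewrite ler_sqr ?nnegrE ?(ltW s0).
pose i j := Num.truncn (M%:R * `|y j| / s).
have arg_ge0 j : 0 <= M%:R * `|y j| / s by rewrite divr_ge0 ?mulr_ge0// ltW.
have iM j : (i j < M.+1)%N.
  rewrite ltnS -(ler_nat R); apply: (@le_trans _ _ (M%:R * `|y j| / s)).
    by rewrite truncn_le.
  by rewrite ler_pdivrMr// ler_wpM2l// ltW.
have i_le j : (i j)%:R / M%:R <= `|y j| / s.
  by rewrite ler_pdivrMr// mulrAC [_ * M%:R]mulrC truncn_le.
have i_ge j : `|y j| / s - M%:R^-1 <= (i j)%:R / M%:R.
  rewrite lerBlDr -[X in _ + X]mul1r -mulrDl natr1 ler_pdivlMr// mulrC mulrA ltW//.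
  by have /andP[] := truncn_itv (arg_ge0 j).
exists [ffun j => (y j < 0, inord (i j))].
set g := [ffun _ => _].
have vE j : grid_vector R g j = (-1) ^+ (y j < 0)%R * ((i j)%:R / M%:R).
  by rewrite /grid_vector ffunE/= inordK// mulrA.
have vy j : grid_vector R g j * y j = (i j)%:R / M%:R * `|y j|.
  rewrite vE; have [yj|yj] := ltrP (y j) 0.
    by rewrite ltr0_norm// expr1; ring.
  by rewrite ger0_norm// expr0 mul1r.
have i0 j : 0 <= (i j)%:R / M%:R :> R by rewrite divr_ge0.
split.
- apply: (@le_trans _ _ (\sum_j (y j ^+ 2 / s ^+ 2))); last first.
    by rewrite -mulr_suml -/q -sq divff// expf_neq0.
  apply: ler_sum => j _; rewrite vE exprMn sqrr_sign mul1r.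
  rewrite -[y j ^+ 2]real_normK ?num_real// -expr_div_n.
  by rewrite lerXn2r ?nnegrE// divr_ge0// ltW.
- by apply: sumr_ge0 => j _; rewrite vy mulr_ge0.
- apply: (@le_trans _ _ (\sum_j (y j ^+ 2 / s - s / M%:R))).
    rewrite sumrB -mulr_suml -/q -sq sumr_const -mulr_natl le_eqVlt; apply/orP; left; apply/eqP.
    by field; rewrite !gt_eqF.
  apply: ler_sum => j _; rewrite vy.
  apply: le_trans (ler_wpM2r (normr_ge0 _) (i_ge j)).
  have -> : y j ^+ 2 = `|y j| ^+ 2 by rewrite real_normK ?num_real.
  rewrite mulrBl; have -> : `|y j| / s * `|y j| = `|y j| ^+ 2 / s by ring.
  by rewrite lerD2l lerN2 mulrC ler_wpM2r ?invr_ge0// ltW.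
Qed.

(** * The Potts kernel *)

(** As a matrix, k I - J with J all ones: k times the orthogonal projection onto the vectors of sum
    0. *)
Definition potts_kernel (R : nzRingType) k (a b : 'I_k) : R := k%:R * (a == b)%:R - 1.

Section PottsKernel.
Variables (R : realType) (k : nat).
Hypothesis k_gt0 : (0 < k)%N.
Local Notation K := (@potts_kernel R k).

Let k_pos : 0 < k%:R :> R. Proof. by rewrite ltr0n. Qed.
Let k_neq0 : k%:R != 0 :> R. Proof. by rewrite gt_eqF. Qed.

Lemma sum_mul_delta (b : 'I_k) (w : 'I_k -> R) : \sum_a (b == a)%:R * w a = w b.
Proof.
rewrite (bigD1 b)//= eqxx mul1r big1 ?addr0// => a; rewrite eq_sym => /negbTE ->.
by rewrite mul0r.
Qed.

Lemma sum_potts_kernel_mul (b : 'I_k) (w : 'I_k -> R) :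
  \sum_a K b a * w a = k%:R * w b - \sum_a w a.
Proof.
under eq_bigr => a _ do rewrite mulrBl mul1r -mulrA.
by rewrite sumrB -mulr_sumr sum_mul_delta.
Qed.

Lemma potts_kernelC (a b : 'I_k) : K a b = K b a.
Proof. by rewrite /potts_kernel eq_sym. Qed.

Lemma avg_potts_kernel (b : 'I_k) : avg (fun a => K a b) = 0.
Proof.
rewrite /avg; under eq_bigr => a _ do rewrite potts_kernelC -[K b a]mulr1.
by rewrite (sum_potts_kernel_mul b (fun _ => 1)) sumr_const card_ord mulr1 subrr mul0r.
Qed.

Lemma potts_kernel_gram (a b : 'I_k) : \sum_c K a c * K b c = k%:R * K a b.
Proof.
rewrite sum_potts_kernel_mul; under eq_bigr => c _ do rewrite -[K b c]mulr1.
rewrite (sum_potts_kernel_mul b (fun _ => 1)) sumr_const card_ord mulr1 subrr subr0.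
by rewrite potts_kernelC.
Qed.

Lemma potts_kernel_norm_le (a b : 'I_k) : `|K a b| <= k%:R.
Proof.
have : 1 <= k%:R :> R by rewrite ler1n.
rewrite /potts_kernel; case: (a == b); rewrite ?mulr1 ?mulr0 => h; rewrite ler_norml; lra.
Qed.

(** The operator norm is at most k: with s the sum of w, the left side equals k^2 |w|^2 - k s^2. *)
Lemma sum_sqr_potts_kernel_mul_le (w : 'I_k -> R) :
  \sum_a (\sum_c K a c * w c) ^+ 2 <= k%:R ^+ 2 * \sum_a w a ^+ 2.
Proof.
under eq_bigr => a _ do rewrite sum_potts_kernel_mul.
set s := \sum_c w c; have hs : \sum_c w c = s by []; clearbody s.
have -> : \sum_a (k%:R * w a - s) ^+ 2 =
    k%:R ^+ 2 * (\sum_a w a ^+ 2) - 2 * k%:R * s * (\sum_a w a) + \sum_(a < k) s ^+ 2.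
  rewrite !mulr_sumr -sumrB -big_split; apply: eq_bigr => a _ /=; ring.
rewrite sumr_const card_ord hs -[_ *+ k]mulr_natl.
have : 0 <= k%:R * s ^+ 2 by rewrite mulr_ge0 ?sqr_ge0.
nra.
Qed.

(** Inner product of v with the vector K(a, c1) K(b, c2) / k indexed by c: what a vertex with labels
    a and b adds to the component of W along v. *)
Definition overlap_direction (v : 'I_k * 'I_k -> R) (a b : 'I_k) : R :=
  k%:R^-1 * \sum_c v c * (K a c.1 * K b c.2).

Lemma avg_overlap_direction v :
  avg (fun q : 'I_k * 'I_k => overlap_direction v q.1 q.2) = 0.
Proof.
rewrite avgZ avg_sum big1 ?mulr0// => c _.
by rewrite avgZ (avg_mul (fun a => K a c.1) (fun b => K b c.2)) !avg_potts_kernel mul0r mulr0.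
Qed.

(** The operator norm bound, used once for each tensor factor, gives k^4; the scaling 1 / k^2 and
    the average over k^2 pairs of labels cancel it. *)
Lemma avg_sqr_overlap_direction_le v :
  avg (fun q : 'I_k * 'I_k => overlap_direction v q.1 q.2 ^+ 2) <= \sum_c v c ^+ 2.
Proof.
under eq_avg => q do rewrite exprMn.
rewrite avgZ /avg card_prod card_ord natrM.
rewrite -(pair_big xpredT xpredT (fun a b : 'I_k =>
  (\sum_c v c * (K a c.1 * K b c.2)) ^+ 2))/=.
have step1 : \sum_a \sum_b (\sum_c v c * (K a c.1 * K b c.2)) ^+ 2 <=
    k%:R ^+ 2 * \sum_b \sum_c (\sum_c' K b c' * v (c, c')) ^+ 2.
  rewrite exchange_big/= mulr_sumr; apply: ler_sum => b _.
  apply: le_trans (sum_sqr_potts_kernel_mul_le _).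
  rewrite le_eqVlt; apply/orP; left; apply/eqP; apply: eq_bigr => a _; congr (_ ^+ 2).
  under [RHS]eq_bigr => c _ do rewrite mulr_sumr.
  by rewrite pair_big/=; apply: eq_bigr => -[c c'] _ /=; ring.
have step2 : \sum_b \sum_c (\sum_c' K b c' * v (c, c')) ^+ 2 <=
    k%:R ^+ 2 * \sum_c v c ^+ 2.
  rewrite exchange_big/=.
  have -> : \sum_c v c ^+ 2 = \sum_c \sum_c' v (c, c') ^+ 2.
    by rewrite pair_big/=; apply: eq_bigr => -[].
  by rewrite mulr_sumr; apply: ler_sum => c _; exact: sum_sqr_potts_kernel_mul_le.
have k2 : 0 < k%:R ^+ 2 :> R by rewrite exprn_gt0.
have h := le_trans step1 (ler_wpM2l (ltW k2) step2).
set S := (X in X / _).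
have -> : k%:R^-1 ^+ 2 * (S / (k%:R * k%:R)) = S / (k%:R ^+ 2 * k%:R ^+ 2) by field.
by rewrite ler_pdivrMr ?mulr_gt0//; apply: le_trans h _; rewrite mulrA mulrC.
Qed.

Lemma overlap_direction_norm_le v a b :
  \sum_c v c ^+ 2 <= 1 -> `|overlap_direction v a b| <= k%:R ^+ 3.
Proof.
move=> v1; rewrite /overlap_direction normrM ger0_norm ?invr_ge0// ler_pdivrMl//.
apply: le_trans (ler_norm_sum _ _ _) _.
have -> : k%:R * k%:R ^+ 3 = \sum_(c : 'I_k * 'I_k) k%:R ^+ 2 :> R.
  by rewrite sumr_const card_prod card_ord -[RHS]mulr_natl natrM; ring.
apply: ler_sum => c _; rewrite !normrM expr2.
have vc : `|v c| <= 1.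
  rewrite -(@expr_le1 _ 2)// real_normK ?num_real//; apply: le_trans v1.
  by rewrite (bigD1 c)//= lerDl sumr_ge0// => j _; rewrite sqr_ge0.
rewrite -[leRHS]mul1r ler_pM ?mulr_ge0 ?normr_ge0// ler_pM ?normr_ge0//;
  exact: potts_kernel_norm_le.
Qed.

Lemma sum_overlap_direction n (v : 'I_k * 'I_k -> R) (s t : {ffun 'I_n -> 'I_k}) :
  \sum_u overlap_direction v (s u) (t u) =
  \sum_c v c * (k%:R^-1 * \sum_u K (s u) c.1 * K (t u) c.2).
Proof.
rewrite -mulr_sumr exchange_big/= mulr_sumr; apply: eq_bigr => c _.
by rewrite -mulr_sumr mulrCA.
Qed.

(** Both kernels are expanded by K(a, b) = k^-1 sum_c K(a, c) K(b, c); the right side is |W|^2. *)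
Lemma sum_pairs_potts_kernel n (s t : {ffun 'I_n -> 'I_k}) :
  \sum_(u : 'I_n) \sum_(v : 'I_n) K (s u) (s v) * K (t u) (t v) =
  \sum_(c : 'I_k * 'I_k) (k%:R^-1 * \sum_u K (s u) c.1 * K (t u) c.2) ^+ 2.
Proof.
under [RHS]eq_bigr => c _ do rewrite exprMn [_ ^+ 2 in X in _ * X]expr2 big_distrlr/=.
rewrite -mulr_sumr.
have -> : \sum_(c : 'I_k * 'I_k) \sum_(u : 'I_n) \sum_(v : 'I_n)
      K (s u) c.1 * K (t u) c.2 * (K (s v) c.1 * K (t v) c.2) =
    \sum_(u : 'I_n) \sum_(v : 'I_n) k%:R ^+ 2 * (K (s u) (s v) * K (t u) (t v)).
  rewrite exchange_big/=; apply: eq_bigr => u _.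
  rewrite exchange_big/=; apply: eq_bigr => v _.
  rewrite expr2 mulrACA -!potts_kernel_gram big_distrlr/= pair_big/=.
  by apply: eq_bigr => c _; ring.
under [in RHS]eq_bigr => u _ do rewrite -mulr_sumr.
by rewrite -mulr_sumr mulrA -exprMn mulVf// expr1n mul1r.
Qed.

End PottsKernel.

(** * Exponential moments of the overlap *)

(** Vertices are independent, so this is the n-th power of the exponential moment at one vertex,
    where the variance is at most 1. *)
Lemma avg_expR_overlap_le (R : realType) k n (v : 'I_k * 'I_k -> R) (delta x0 t : R) :
  (0 < k)%N -> \sum_c v c ^+ 2 <= 1 -> 0 <= delta ->
  (forall x, `|x| <= x0 -> expR x <= 1 + x + (1 + delta) / 2 * x ^+ 2) ->
  `|t| * k%:R ^+ 3 <= x0 ->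
  avg (fun p : {ffun 'I_n -> 'I_k} * {ffun 'I_n -> 'I_k} =>
    expR (t * \sum_u overlap_direction v (p.1 u) (p.2 u))) <=
  expR (n%:R * ((1 + delta) / 2 * t ^+ 2)).
Proof.
move=> k0 v1 delta0 hexp ht.
under eq_avg => p do rewrite mulr_sumr expR_sum.
rewrite (avg_ffun_prod n (fun a b => expR (t * overlap_direction v a b))) expRM_natl.
rewrite lerXn2r ?nnegrE ?expR_ge0//; first by apply: avg_ge0 => p; exact: expR_ge0.
apply: (avg_expR_le _ _ _ _ delta0 hexp ht).
- by rewrite card_prod card_ord muln_gt0 k0.
- exact: avg_overlap_direction.
- by apply: le_trans v1; exact: avg_sqr_overlap_direction_le.
- by move=> q; exact: overlap_direction_norm_le.
Qed.

(** Some grid direction is nearly aligned with W, so the average is at most a finite sum of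
    one-dimensional averages, each controlled by the level bound with threshold eps sqrt n. *)
Lemma avg_truncated_exp_overlap_bounded (R : realType) k (c : R) :
  (0 < k)%N -> 0 <= c -> c < 1 ->
  exists C kappa A : R, [/\ 0 < kappa, 1 <= A &
    forall (n D : nat) (lam : R), (0 < n)%N -> 0 <= lam -> lam * n%:R <= c ->
      (A * n%:R) ^+ D <= expR (kappa * n%:R) ->
      avg (fun p : {ffun 'I_n -> 'I_k} * {ffun 'I_n -> 'I_k} =>
        truncated_exp D (lam * (2^-1 * \sum_u \sum_v
          potts_kernel R (p.1 u) (p.1 v) * potts_kernel R (p.2 u) (p.2 v)))) <= C].
Proof.
move=> k0 c0 c1.
have kR : 0 < k%:R :> R by rewrite ltr0n.
(* Three gaps below 1: from c to c2 pays for rounding to the grid, from c2 to c3 makes the sum over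
   levels converge, from c3 to 1 allows for the factor 1 + delta = 1 / c3 in the moment bound. *)
pose c2 := (2 * c + 1) / 3; pose c3 := (c + 2) / 3.
have cc2 : c < c2 by rewrite /c2; lra.
have c23 : c2 < c3 by rewrite /c2 /c3; lra.
have c31 : c3 < 1 by rewrite /c3; lra.
have c20 : 0 < c2 by apply: le_lt_trans cc2.
have c30 : 0 < c3 by apply: lt_trans c23.
clearbody c2 c3.
have delta0 : 0 < c3^-1 - 1 by rewrite subr_gt0 invf_gt1.
have [x0 x00 hexp] := expR_le_quadratic delta0.
(* This choice gives c = c2 (1 - 2 rho) <= c2 (1 - rho)^2. *)
pose rho := (c2 - c) / (2 * c2).
have rho0 : 0 < rho by rewrite divr_gt0 ?subr_gt0 ?mulr_gt0.
have rhoE : c2 * (1 - 2 * rho) = c by rewrite /rho; field; rewrite gt_eqF.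
have rho1 : rho < 1 by rewrite /rho ltr_pdivrMr ?mulr_gt0//; lra.
clearbody rho.
pose J := ('I_k * 'I_k)%type.
(* Fine enough for the relative grid loss k^2 / M to be at most rho. *)
pose M := (Num.truncn (#|{: J}|%:R / rho)).+1.
have NM : #|{: J}|%:R / M%:R <= rho.
  rewrite ler_pdivrMr ?ltr0n// mulrC -ler_pdivrMr// ltW//.
  by have /andP[] := truncn_itv (divr_ge0 (ler0n R #|{: J}|) (ltW rho0)).
(* With this value as [eps], a tilt up to c3 eps sqrt n, divided by sqrt n, stays within the range
   x0 / k^3 of the moment bound. *)
have eps0 : 0 < x0 / (c3 * k%:R ^+ 3) by rewrite divr_gt0// mulr_gt0// exprn_gt0.
have epsE : c3 * (x0 / (c3 * k%:R ^+ 3)) * k%:R ^+ 3 = x0.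
  by field; rewrite !gt_eqF.
move: (x0 / _) eps0 epsE => eps eps0 epsE.
have [C1 hC1] : exists C1 : R, forall j : nat,
    \sum_(i < j) expR (c2 * i%:R - (c3 - c2) / 2 * i%:R ^+ 2) <= C1.
  by apply: sum_expR_quadratic_bounded; rewrite divr_gt0// subr_gt0.
pose C2 := 1 + expR (c2 / 2) * C1 + expR 1.
(* Since |X| <= k^3 sqrt n, this gives c2 / 2 X^2 <= A n; the summand 1 ensures A n >= 1. *)
pose A := c2 / 2 * k%:R ^+ 6 + 1.
have A1 : 1 <= A by rewrite /A lerDr mulr_ge0 ?exprn_ge0 ?divr_ge0 ?ltW.
exists (\sum_(g : {ffun J -> bool * 'I_M.+1} | \sum_j grid_vector R g j ^+ 2 <= 1) C2).
exists (c3 / 2 * eps ^+ 2), A; split => //.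
  by rewrite mulr_gt0 ?divr_gt0 ?exprn_gt0.
move=> n D lam n0 lam0 lamn powD.
have nR : 0 < n%:R :> R by rewrite ltr0n.
pose r := Num.sqrt n%:R : R.
have r0 : 0 < r by rewrite sqrtr_gt0.
have r2 : r ^+ 2 = n%:R by rewrite sqr_sqrtr// ltW.
clearbody r.
(* Cutting at 0 makes F nonnegative everywhere and at most 1 on negative projections, as the
   one-sided level bound requires. *)
pose F (x : R) := truncated_exp D (c2 / 2 * Num.max 0 x ^+ 2).
have F_ge0 x : 0 <= F x.
  by rewrite truncated_exp_ge0// mulr_ge0 ?sqr_ge0// divr_ge0// ltW.
have F_pos x : 0 <= x -> F x = truncated_exp D (c2 / 2 * x ^+ 2).
  by move=> xge0; rewrite /F; have -> : Num.max 0 x = x by apply/max_idPr.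
pose X (g : {ffun J -> bool * 'I_M.+1}) (p : {ffun 'I_n -> 'I_k} * {ffun 'I_n -> 'I_k}) : R :=
  (\sum_u overlap_direction (grid_vector R g) (p.1 u) (p.2 u)) / r.
have pointwise (p : {ffun 'I_n -> 'I_k} * {ffun 'I_n -> 'I_k}) : truncated_exp D (lam * (2^-1 * \sum_u \sum_v
      potts_kernel R (p.1 u) (p.1 v) * potts_kernel R (p.2 u) (p.2 v))) <=
    \sum_(g : {ffun J -> bool * 'I_M.+1} | \sum_j grid_vector R g j ^+ 2 <= 1) F (X g p).
  rewrite sum_pairs_potts_kernel//.
  set W := fun c : J => k%:R^-1 * \sum_u potts_kernel R (p.1 u) c.1 * potts_kernel R (p.2 u) c.2.
  (* The term of the nearly aligned direction alone dominates; the others are nonnegative. *)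
  have [g [g1 gW0 gW]] := @exists_grid_direction R J M W isT.
  rewrite (bigD1 g)//= -[leLHS]addr0 lerD ?sumr_ge0//.
  have XE : \sum_j grid_vector R g j * W j = X g p * r.
    by rewrite /X mulfVK ?gt_eqF// sum_overlap_direction.
  rewrite XE in gW0 gW.
  have X0 : 0 <= X g p by move: gW0; rewrite pmulr_lge0.
  rewrite F_pos//; set q := \sum_(c : J) _ in gW *.
  have q0 : 0 <= q by apply: sumr_ge0 => j _; rewrite sqr_ge0.
  apply: le_truncated_exp; first by rewrite !mulr_ge0.
  have sq : (1 - rho) * Num.sqrt q <= X g p * r.
    by apply: le_trans gW; rewrite ler_wpM2r ?sqrtr_ge0// lerB.
  have sq2 : (1 - rho) ^+ 2 * q <= X g p ^+ 2 * n%:R.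
    rewrite -r2 -[in leLHS](sqr_sqrtr q0) -!exprMn lerXn2r//.
    by rewrite nnegrE mulr_ge0 ?sqrtr_ge0// subr_ge0 ltW.
  rewrite -(@ler_pM2r _ n%:R)//.
  have -> : lam * (2^-1 * q) * n%:R = lam * n%:R * q / 2 by ring.
  have -> : c2 / 2 * X g p ^+ 2 * n%:R = c2 * (X g p ^+ 2 * n%:R) / 2 by ring.
  rewrite ler_pM2r ?invr_gt0//; apply: le_trans (ler_wpM2r q0 lamn) _.
  apply: le_trans (ler_wpM2l (ltW c20) sq2); rewrite mulrA ler_wpM2r// -rhoE ler_wpM2l ?(ltW c20)//.
  rewrite -subr_ge0; have -> : (1 - rho) ^+ 2 - (1 - 2 * rho) = rho ^+ 2 by ring.
  exact: sqr_ge0.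
apply: le_trans (le_avg pointwise) _; rewrite avg_sum; apply: ler_sum => g g1.
have cardP : (0 < #|{: {ffun 'I_n -> 'I_k} * {ffun 'I_n -> 'I_k}}|)%N.
  by rewrite card_prod card_ffun !card_ord muln_gt0 expn_gt0 k0.
have a0 : 0 <= eps * r by rewrite mulr_ge0 ?ltW.
have bigM0 : 0 <= expR (c3 / 2 * eps ^+ 2 * n%:R) * expR 1 by rewrite mulr_ge0 ?expR_ge0.
have mgf t : 0 <= t <= c3 * (eps * r) ->
    avg (fun p : {ffun 'I_n -> 'I_k} * {ffun 'I_n -> 'I_k} => expR (t * X g p)) <=
    expR (t ^+ 2 / (2 * c3)).
  case/andP=> t0 ta.
  have -> : t ^+ 2 / (2 * c3) = n%:R * ((1 + (c3^-1 - 1)) / 2 * (t / r) ^+ 2).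
    by rewrite -r2; field; rewrite !gt_eqF.
  have tX p : expR (t * X g p) =
      expR (t / r * \sum_u overlap_direction (grid_vector R g) (p.1 u) (p.2 u)).
    by rewrite /X mulrA mulrAC.
  have htr : `|t / r| * k%:R ^+ 3 <= x0.
    rewrite ger0_norm ?divr_ge0 ?(ltW r0)// -epsE ler_wpM2r ?exprn_ge0//.
    by rewrite ler_pdivrMr// -mulrA.
  rewrite (eq_avg tX).
  exact: (avg_expR_overlap_le n k0 g1 (ltW delta0) hexp htr).
apply: le_trans (avg_level_bound (X := X g) cardP a0 (ltW c20) c30 bigM0 mgf _ _ _) _.
- move=> p X0; rewrite /F; have -> : Num.max 0 (X g p) = 0 by apply/max_idPl.
  by rewrite expr0n mulr0 -expR0; exact: truncated_exp_le_expR.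
- move=> p /andP[X0 _]; rewrite F_pos//; apply: truncated_exp_le_expR.
  by rewrite mulr_ge0 ?sqr_ge0// divr_ge0// ltW.
- move=> p Xa; have X0 := le_trans a0 Xa; rewrite F_pos//.
  have Xr : X g p * r <= k%:R ^+ 3 * n%:R.
    rewrite /X mulfVK ?gt_eqF//; apply: (le_trans (ler_norm _)).
    apply: (le_trans (ler_norm_sum _ _ _)).
    rewrite mulr_natr -[X in _ *+ X](card_ord n) -sumr_const; apply: ler_sum => u _.
    exact: overlap_direction_norm_le.
  (* Above the threshold the argument is at most A n, so the truncated series is at most e (A n)^D,
     hence at most e exp(kappa n). *)
  have An1 : 1 <= A * n%:R by rewrite -[leLHS]mulr1 ler_pM// ler1n.
  apply: (@le_trans _ _ (truncated_exp D (A * n%:R))).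
    apply: le_truncated_exp; first by rewrite mulr_ge0 ?sqr_ge0// divr_ge0// ltW.
    have X2 : X g p ^+ 2 <= k%:R ^+ 6 * n%:R.
      rewrite -(@ler_pM2r _ n%:R)// -{1}r2 -exprMn.
      have -> : k%:R ^+ 6 * n%:R * n%:R = (k%:R ^+ 3 * n%:R) ^+ 2 :> R by ring.
      by rewrite lerXn2r// nnegrE mulr_ge0 ?exprn_ge0// ?ltW.
    have -> : A * n%:R = c2 / 2 * (k%:R ^+ 6 * n%:R) + n%:R by rewrite /A; ring.
    by rewrite -[leLHS]addr0 lerD ?(ltW nR)// ler_wpM2l ?divr_ge0// ltW.
  apply: le_trans (truncated_exp_le_pow _ An1) _.
  by rewrite ler_wpM2r ?expR_ge0.
rewrite /C2 -!addrA lerD2l lerD//.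
  apply: le_trans (ler_wpM2l (expR_ge0 _) (hC1 (Num.truncn (eps * r)).+1)).
  rewrite mulr_sumr; apply: ler_sum => j _; rewrite -expRD ler_expR le_eqVlt.
  by apply/orP; left; apply/eqP; field.
(* Since a^2 = eps^2 n, kappa n is exactly c3 / 2 a^2: the exponentials cancel and e remains. *)
rewrite mulrAC -expRD exprMn r2.
have -> : c3 / 2 * eps ^+ 2 * n%:R + - (c3 / 2 * (eps ^+ 2 * n%:R)) = 0 by ring.
by rewrite expR0 mul1r.
Qed.

(** * Likelihood ratio *)

Section LikelihoodCoefficients.
Variables (R : realType) (k n : nat) (d eta : R).
Hypotheses (d_gt0 : 0 < d) (d_lt_n : d < n%:R).
Let p := d / n%:R.

Let n_gt0 : 0 < n%:R :> R. Proof. exact: lt_trans d_lt_n. Qed.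
Let p_gt0 : 0 < p. Proof. by rewrite divr_gt0. Qed.
Let p_lt1 : p < 1. Proof. by rewrite ltr_pdivrMr// mul1r. Qed.

Lemma Qmass_neq0 (G : graph n) : Qmass d G != 0.
Proof.
apply/prodf_neq0 => e _; rewrite -/p /bernoulli_pmf.
by case: (G e); rewrite ?subr_eq0 gt_eqF.
Qed.

Lemma sbm_edge_prob_sub (s : {ffun 'I_n -> 'I_k}) (e : edge n) :
  sbm_edge_prob d eta s e - p =
  eta * p * potts_kernel R (s (val e).1) (s (val e).2).
Proof.
by rewrite /sbm_edge_prob /potts_kernel /p; case: eqP => _ /=; field; exact: lt0r_neq0.
Qed.

(** The weight Q cancels the denominator of L. Given the labels, edges are independent and each
    centred indicator has mean eta p K. *)
Lemma Q_inner_likelihood_character (A : {set edge n}) :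
  Q_inner d (@likelihood_ratio R k d eta n) (edge_character p A) =
  (eta * p) ^+ #|A| * avg (fun s : {ffun 'I_n -> 'I_k} =>
    \prod_(e in A) potts_kernel R (s (val e).1) (s (val e).2)).
Proof.
rewrite /Q_inner /likelihood_ratio.
under eq_bigr => G _ do rewrite mulrA [Qmass d G * _]mulrC divfK ?Qmass_neq0// /Pmass mulr_suml.
rewrite exchange_big/= -avgZ /avg card_ffun !card_ord natrX mulr_suml.
apply: eq_bigr => s _.
under eq_bigr => G _ do rewrite -mulrA /edge_character [\prod_(e in A) _]big_mkcond -big_split/=.
rewrite -mulr_sumr (sum_graph_prod (fun e b => bernoulli_pmf (sbm_edge_prob d eta s e) b *
   (if e \in A then b%:R - p else 1))) exprVn mulrC; congr (_ / _).
rewrite -prodr_const -big_split [RHS]big_mkcond; apply: eq_bigr => e _ /=.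
case: ifP => _ /=; last by ring.
rewrite -sbm_edge_prob_sub; ring.
Qed.

Lemma sum_pairs_edges (x : 'I_n -> 'I_n -> R) : (forall u v, x u v = x v u) ->
  \sum_u \sum_v x u v = \sum_u x u u + 2 * \sum_(e : edge n) x (val e).1 (val e).2.
Proof.
move=> xC.
have edgeE : \sum_(e : edge n) x (val e).1 (val e).2 =
    \sum_(u < n) \sum_(v < n | (u < v)%N) x u v.
  rewrite pair_big_dep/= (reindex_omap (fun e : edge n => val e) insub)/=; last first.
    by move=> e he; rewrite insubT.
  apply: eq_bigl => e; rewrite (valP e) /=.
  by apply/esym/eqP; rewrite valK.
have edgeE' : \sum_(e : edge n) x (val e).1 (val e).2 =
    \sum_(u < n) \sum_(v < n | (v < u)%N) x u v.
  rewrite edgeE (exchange_big_dep predT)//=.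
  by apply: eq_bigr => u _; apply: eq_bigr => v _; exact: xC.
rewrite mulr2n mulrDl mul1r {1}edgeE edgeE' -!big_split; apply: eq_bigr => u _ /=.
rewrite (bigD1 u)//=; congr (_ + _).
rewrite (bigID (fun v : 'I_n => (u < v)%N))/=; congr (_ + _); apply: eq_bigl => v.
  by rewrite -(inj_eq val_inj); case: ltngtP.
by rewrite -leqNgt ltn_neqAle -(inj_eq val_inj).
Qed.

Lemma Q_inner_orth_proj_likelihood_le D (g : graph n -> R) :
  is_orth_proj d (@poly_deg_le R n D) (@likelihood_ratio R k d eta n) g ->
  Q_inner d g g <=
  avg (fun q : {ffun 'I_n -> 'I_k} * {ffun 'I_n -> 'I_k} =>
    truncated_exp D (eta ^+ 2 * d / (n%:R - d) * (2^-1 * \sum_u \sum_v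
      potts_kernel R (q.1 u) (q.1 v) * potts_kernel R (q.2 u) (q.2 v)))).
Proof.
move=> hg; apply: le_trans (Q_inner_orth_proj_le d_gt0 d_lt_n hg) _.
set lam := eta ^+ 2 * d / (n%:R - d).
have lam0 : 0 <= lam.
  by rewrite /lam divr_ge0 ?(mulr_ge0 (sqr_ge0 _) (ltW d_gt0))// subr_ge0 ltW.
pose K (s : {ffun 'I_n -> 'I_k}) (e : edge n) :=
  potts_kernel R (s (val e).1) (s (val e).2).
apply: (@le_trans _ _ (\sum_(A : {set edge n} | (#|A| <= D)%N)
    lam ^+ #|A| * avg (fun s => \prod_(e in A) K s e) ^+ 2)).
  (* Each edge costs (eta p)^2 / (p (1 - p)) = eta^2 d / (n - d). *)
  rewrite le_eqVlt; apply/orP; left; apply/eqP; apply: eq_bigr => A _.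
  rewrite Q_inner_likelihood_character exprMn mulrAC -exprM mulnC exprM -expr_div_n.
  congr (_ ^+ _ * _); rewrite /lam /p; field.
  by rewrite !gt_eqF ?subr_gt0.
apply: le_trans (sum_sqr_avg_prod_le K D lam0) _.
(* Half of the diagonal u = v, where K = k - 1: a constant that completes the edge sum to half of
   the full double sum. *)
have c0 : 0 <= 2^-1 * \sum_(u < n) (k%:R - 1) ^+ 2 :> R.
  by rewrite mulr_ge0 ?sumr_ge0// => u _; rewrite sqr_ge0.
apply: le_trans (avg_truncated_exp_le_add K D lam0 c0) _.
apply: le_avg => q; rewrite le_eqVlt; apply/orP; left; apply/eqP; congr truncated_exp; congr (_ * _).
rewrite (sum_pairs_edges (x := fun u v => potts_kernel R (q.1 u) (q.1 v) * potts_kernel R (q.2 u) (q.2 v))).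
  rewrite mulrDr mulrA mulVf ?pnatr_eq0// mul1r; congr (_ * _ + _).
  by apply: eq_bigr => u _; rewrite /potts_kernel !eqxx mulr1 expr2.
by move=> u v; rewrite potts_kernelC [X in _ * X]potts_kernelC.
Qed.

End LikelihoodCoefficients.

(** * The degree condition and the conclusion *)

(** Once n >= A, ln (A n) <= 2 ln n, while D <= (kappa / 2) n / ln n; hence D ln (A n) <= kappa
    n. *)
Lemma pow_le_expR_of_littleo (R : realType) (D : nat -> nat) (A kappa : R) :
  (fun n : nat => (D n)%:R : R) =o_\oo (fun n : nat => n%:R / ln n%:R : R) ->
  1 <= A -> 0 < kappa ->
  \forall n \near \oo, (A * n%:R) ^+ D n <= expR (kappa * n%:R).
Proof.
move=> /eqoP hD A1 kappa0; near=> n.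
have n2 : (1 < n)%N by near: n; exact: nbhs_infty_gt.
have An : A <= n%:R by near: n; exact: nbhs_infty_ger.
have n0 : 0 < n%:R :> R by rewrite ltr0n (ltn_trans _ n2).
have ln0 : 0 < ln n%:R :> R by rewrite ln_gt0// ltr1n.
have Dn : `|(D n)%:R : R| <= kappa / 2 * `|n%:R / ln n%:R : R|.
  by near: n; apply: hD; rewrite divr_gt0.
rewrite !ger0_norm ?divr_ge0 ?(ltW ln0)// in Dn.
have A0 : 0 < A := lt_le_trans ltr01 A1.
have An0 : 0 < A * n%:R by rewrite mulr_gt0.
rewrite -[A * n%:R]lnK ?posrE// -expRM_natl ler_expR lnM ?posrE//.
have lnA : ln A <= ln n%:R by rewrite ler_ln ?posrE.
have lnA0 : 0 <= ln A by rewrite ln_ge0.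
apply: (@le_trans _ _ (kappa / 2 * (n%:R / ln n%:R) * (2 * ln n%:R))).
  by apply: ler_pM => //; [rewrite addr_ge0// ltW|lra].
by rewrite le_eqVlt; apply/orP; left; apply/eqP; field; rewrite gt_eqF.
Unshelve. all: by end_near. Qed.

Theorem theorem2p20 (R : realType) (k : nat) (d eta : R)
  (hk : (2 <= k)%N) (hd : 0 < d)
  (heta_ge : - (1 / (k%:R - 1)) <= eta) (heta_le : eta <= 1)
  (hKS : d * eta ^+ 2 < 1)
  (D : nat -> nat)
  (hD : (fun n : nat => (D n)%:R : R) =o_\oo
          (fun n : nat => n%:R / ln n%:R : R)) :
  (fun n : nat => Q_norm d (@low_deg_likelihood R k d eta n (D n)))
    =O_\oo (fun _ : nat => 1 : R).
Proof.
(* The midpoint of d eta^2 and 1; the gap absorbs the ratio n / (n - d). *)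
pose c := (d * eta ^+ 2 + 1) / 2.
have de0 : 0 <= d * eta ^+ 2 by rewrite mulr_ge0 ?sqr_ge0 ?ltW.
have c0 : 0 <= c by rewrite /c; lra.
have c1 : c < 1 by rewrite /c; lra.
have dc : d * eta ^+ 2 < c by rewrite /c; lra.
clearbody c.
have [C [kappa [A [kappa0 A1 hC]]]] := avg_truncated_exp_overlap_bounded (ltnW hk) c0 c1.
apply/eqO_exP; exists (Num.sqrt C + 1); first by rewrite ltr_wpDl ?sqrtr_ge0.
near=> n.
rewrite normr1 mulr1 ger0_norm ?sqrtr_ge0//.
have powD : (A * n%:R) ^+ D n <= expR (kappa * n%:R).
  by near: n; exact: pow_le_expR_of_littleo.
have n0 : (0 < n)%N by near: n; exact: nbhs_infty_gt.
have dn : d < n%:R.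
  apply: (@lt_le_trans _ _ (d + 1)); first by rewrite ltrDl.
  by near: n; exact: nbhs_infty_ger.
(* For n > d this is equivalent to d eta^2 n / (n - d) <= c. *)
have cn : c * d / (c - d * eta ^+ 2) <= n%:R by near: n; exact: nbhs_infty_ger.
have lamn : eta ^+ 2 * d / (n%:R - d) * n%:R <= c.
  rewrite mulrAC ler_pdivrMr ?subr_gt0//.
  move: cn; rewrite ler_pdivrMr ?subr_gt0//; lra.
have lam0 : 0 <= eta ^+ 2 * d / (n%:R - d).
  by rewrite divr_ge0 ?(mulr_ge0 (sqr_ge0 _) (ltW hd))// subr_ge0 ltW.
(* Shown for every projection, so that it applies to the one chosen by [get]. *)
have bound g : is_orth_proj d (@poly_deg_le R n (D n)) (@likelihood_ratio R k d eta n) g ->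
    Q_norm d g <= Num.sqrt C + 1.
  move=> hg; apply: (@le_trans _ _ (Num.sqrt C)); last by rewrite lerDl.
  apply: ler_wsqrtr; apply: le_trans (Q_inner_orth_proj_likelihood_le hd dn hg) _.
  exact: hC.
rewrite /low_deg_likelihood.
have [ex|nex] := pselect (exists g, is_orth_proj d (@poly_deg_le R n (D n))
    (@likelihood_ratio R k d eta n) g).
  by apply: bound; exact: (getPex ex).
(* [get] of an empty set is the default point of the type, the zero function. *)
rewrite getPN => [|g hg]; last by apply: nex; exists g.
rewrite /Q_norm /Q_inner big1 ?sqrtr0 ?addr_ge0 ?sqrtr_ge0// => G _.
by rewrite mul0r mulr0.
Unshelve. all: by end_near. Qed.
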